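(* Let $F$ be a finitely generated non-abelian free group with finite basis $A$ and let $\varphi$ be an automorphism of $F$. For any $u,v\in F$ with $u\neq v$ there exist finite sets $U,V\subset F$ such that $$\varphi\big(C^2_{[u,v]}\big)=\bigcup_{u_i\in U,\ v_j\in V} C^2_{[u_i,v_j]},$$ where the union is disjoint (the sets $C^2_{[u_i,v_j]}$ for distinct pairs $(u_i,v_j)\in U\times V$ are pairwise disjoint). Moreover, the sets $U$ and $V$ can be algorithmically derived from $u,v$ and from the elements of $\varphi(A)$ and of $\varphi^{-1}(A)$, all expressed as reduced words in $A\cup A^{-1}$; that is, there is an algorithm which, given these reduced words as input, outputs such sets $U$ and $V$.
   Context: Elements of $F$ are identified with finite reduced words in $A\cup A^{-1}$, and the Gromov boundary $\partial F$ is identified with the set of infinite reduced words $x_1x_2x_3\cdots$, $x_i\in A\cup A^{-1}$, $x_i\neq x_{i+1}^{-1}$. Every automorphism $\varphi$ of $F$ induces canonically a homeomorphism of $\partial F$, also denoted $\varphi$ (the continuous extension of $\varphi$ to the boundary). The double boundary is $\partial^2F=(\partial F\times\partial F)\smallsetminus\{\text{diagonal}\}$, and $\varphi$ acts on it by $\varphi(X,Y)=(\varphi(X),\varphi(Y))$. Let $\Gamma$ be the Cayley graph (a tree) of $F$ with respect to $A$; its vertices are identified with the elements of $F$ and its set of ends with $\partial F$. For distinct $X,Y\in\partial F$, $\gamma(X,Y)$ denotes the biinfinite reduced path in $\Gamma$ from the end $X$ to the end $Y$. For $u\neq v$ in $F$ the double cylinder is $$C^2_{[u,v]}=\{(X,Y)\in\partial^2F\mid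 \gamma(X,Y)\text{ passes through } u \text{ and } v \text{ (in that order)}\}.$$ *)

(* Defs.v *)
From HB Require Import structures.
From mathcomp Require Import all_boot all_order all_algebra.
From mathcomp Require Import boolp classical_sets cardinality.
From mathcomp Require Import zify.

Set Implicit Arguments.
Unset Strict Implicit.
Unset Printing Implicit Defensive.

Local Open Scope classical_set_scope.
Local Open Scope group_scope.

(* The free group on A, as the group of reduced words in A and A^-1: the
   letter (a, false) stands for a and (a, true) for a^-1. *)

Definition letter (A : finType) : Type := (A * bool)%type.
HB.instance Definition _ (A : finType) := Finite.on (letter A).

Definition linv (A : finType) (x : letter A) : letter A := (x.1, ~~ x.2).

Definition reduced (A : finType) (w : seq (letter A)) : bool :=
  sorted (fun x y => y != linv x) w.

Record freeGroup (A : finType) : Type :=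
  FreeGroup { word :> seq (letter A); wordP : reduced word }.

HB.instance Definition _ (A : finType) := [isSub for @word A].
HB.instance Definition _ (A : finType) := [Choice of freeGroup A by <:].

Section FreeGroup.
Variable A : finType.
Implicit Types (x y : letter A) (u v w : seq (letter A)).

Definition rcons_letter x w : seq (letter A) :=
  if w is y :: w' then if y == linv x then w' else x :: w else [:: x].

Definition rcat u v : seq (letter A) := foldr rcons_letter v u.

Definition rinv u : seq (letter A) := rev [seq linv x | x <- u].

Lemma linvK : involutive (@linv A).
Proof. by case=> a b; rewrite /linv /= negbK. Qed.

Lemma linv_neq x : linv x != x.
Proof. by case: x => a []; rewrite /linv xpair_eqE /= andbF. Qed.

Lemma eq_linv x y : (x == linv y) = (y == linv x).
Proof. by rewrite -(inj_eq (inv_inj linvK)) linvK eq_sym. Qed.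

Lemma reduced_rcons_letter x w : reduced w -> reduced (rcons_letter x w).
Proof.
case: w => [//|y w] /= rw; case: ifPn => [_|nyx]; first exact: path_sorted rw.
by rewrite /= nyx.
Qed.

Lemma reduced_rcat u v : reduced v -> reduced (rcat u v).
Proof. by move=> rv; elim: u => //= x u; apply: reduced_rcons_letter. Qed.

Lemma reduced_rinv u : reduced u -> reduced (rinv u).
Proof.
rewrite /reduced /rinv rev_sorted sorted_map.
by apply: sub_sorted => x y /=; rewrite linvK eq_sym.
Qed.

Lemma rcons_letterK x w :
  reduced w -> rcons_letter x (rcons_letter (linv x) w) = w.
Proof.
case: w => [|y w] /=; first by rewrite eqxx.
rewrite linvK; case: ifPn => [/eqP-> rw|nyx rw /=]; last by rewrite eqxx.
by case: w rw => [//|z w] /= /andP[/negbTE-> _].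
Qed.

Lemma rcat_cons x u w :
  reduced w -> rcat (rcons_letter x u) w = rcons_letter x (rcat u w).
Proof.
move=> rw; case: u => [//|y u] /=; case: ifPn => [/eqP-> /=|//].
by rewrite rcons_letterK //; apply: reduced_rcat.
Qed.

Lemma rcatA u v w : reduced w -> rcat (rcat u v) w = rcat u (rcat v w).
Proof. by move=> rw; elim: u => //= x u <-; rewrite rcat_cons. Qed.

Lemma rcat_reduced u v : reduced (u ++ v) -> rcat u v = u ++ v.
Proof.
elim: u => //= x u IHu ruv; rewrite IHu; last exact: path_sorted ruv.
by case: (u ++ v) ruv => [//|y w] /= /andP[/negbTE-> _].
Qed.

Lemma rcat_invl u : reduced u -> rcat (rinv u) u = [::].
Proof.
move=> ru; elim: u ru => [//|x u IHu] rxu.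
rewrite /rinv /= rev_cons -cats1 /rcat foldr_cat /= linvK eqxx.
exact: IHu (path_sorted rxu).
Qed.

Lemma rinvK u : rinv (rinv u) = u.
Proof.
by rewrite /rinv map_rev revK -map_comp -[RHS]map_id; apply: eq_map => x /=;
  rewrite linvK.
Qed.

Definition fg_one : freeGroup A := FreeGroup (isT : reduced [::]).
Definition fg_mul (u v : freeGroup A) : freeGroup A :=
  FreeGroup (reduced_rcat u (wordP v)).
Definition fg_inv (u : freeGroup A) : freeGroup A :=
  FreeGroup (reduced_rinv (wordP u)).

Lemma fg_mulA : associative fg_mul.
Proof. by move=> u v w; apply: val_inj; rewrite /= rcatA ?wordP. Qed.

Lemma fg_mul1 : left_id fg_one fg_mul.
Proof. by move=> u; apply: val_inj. Qed.

Lemma fg_mulr1 : right_id fg_one fg_mul.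
Proof.
by move=> u; apply: val_inj; rewrite /= rcat_reduced ?cats0 ?wordP.
Qed.

Lemma fg_mulV : left_inverse fg_one fg_inv fg_mul.
Proof. by move=> u; apply: val_inj; rewrite /= rcat_invl ?wordP. Qed.

Lemma fg_mulrV : right_inverse fg_one fg_inv fg_mul.
Proof.
move=> u; apply: val_inj => /=; rewrite -{1}[word u]rinvK rcat_invl //.
exact: reduced_rinv (wordP u).
Qed.

HB.instance Definition _ :=
  isGroup.Build (freeGroup A) fg_mulA fg_mul1 fg_mulr1 fg_mulV fg_mulrV.

Definition fg_letter x : freeGroup A := FreeGroup (isT : reduced [:: x]).
Definition fg_gen (a : A) : freeGroup A := fg_letter (a, false).

End FreeGroup.

Record automorphism (A : finType) : Type := Automorphism {
  aut :> {multiplicative freeGroup A -> freeGroup A};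
  aut_inv : freeGroup A -> freeGroup A;
  autK : cancel aut aut_inv;
  aut_invK : cancel aut_inv aut }.

(* The boundary, and the compactification of the free group by its boundary.
   A point of the compactification is a finite or infinite reduced word, and
   the points agreeing with a given end on their first k letters, for k in
   nat, form a basis of neighbourhoods of that end; elements of the free
   group are isolated points. *)

Record boundary (A : finType) : Type := Boundary {
  bletter :> nat -> letter A;
  bletterP : forall i, bletter i.+1 != linv (bletter i) }.

Definition compactification (A : finType) : Type :=
  (freeGroup A + boundary A)%type.

Definition letter_at (A : finType) (x : compactification A) (i : nat) :
    option (letter A) :=
  match x with inl w => onth w i | inr X => Some (X i) end.

Definition agree (A : finType) (k : nat) (x y : compactification A) : Prop :=
  forall i, (i < k)%N -> letter_at x i = letter_at y i.

Definition converges_to (A : finType) (w : nat -> freeGroup A)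
    (X : boundary A) : Prop :=
  forall k, exists N, forall n, (N <= n)%N -> agree k (inr X) (inl (w n)).

Definition extend (A : finType) (phi : freeGroup A -> freeGroup A)
    (g : boundary A -> boundary A) (x : compactification A) :
    compactification A :=
  match x with inl w => inl (phi w) | inr X => inr (g X) end.

Definition continuous_extension (A : finType)
    (phi : freeGroup A -> freeGroup A) (g : boundary A -> boundary A) : Prop :=
  forall (X : boundary A) k, exists N, forall y : compactification A,
    agree N (inr X) y -> agree k (extend phi g (inr X)) (extend phi g y).

Section BoundaryMap.
Variable A : finType.
Implicit Types (u v w : freeGroup A) (X Y : boundary A).

Lemma boundary_inj X Y : bletter X =1 bletter Y -> X = Y.
Proof.
case: X Y => [x xP] [y yP] /= /funext exy; case: _ / exy in yP *.
by congr Boundary; apply: Prop_irrelevance.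
Qed.

Lemma agree_trans k (x y z : compactification A) :
  agree k x y -> agree k y z -> agree k x z.
Proof. by move=> xy yz i ik; rewrite xy // yz. Qed.

Lemma agree_sym k (x y : compactification A) : agree k x y -> agree k y x.
Proof. by move=> xy i ik; rewrite xy. Qed.

Lemma agree_leq k l (x y : compactification A) :
  (k <= l)%N -> agree l x y -> agree k x y.
Proof. by move=> kl xy i ik; apply: xy; apply: leq_trans kl. Qed.

Lemma reduced_mkseq X n : reduced (mkseq X n).
Proof.
apply/(sortedP (X 0)) => i; rewrite size_mkseq => lin.
by rewrite !nth_mkseq ?bletterP // ltnW.
Qed.

Definition bprefix X n : freeGroup A := FreeGroup (reduced_mkseq X n).

Lemma onth_word (w : seq (letter A)) i :
  (i < size w)%N -> forall x, onth w i = Some (nth x w i).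
Proof. by move=> iw x; rewrite onthE (nth_map x). Qed.

Lemma agree_bprefix X n : agree n (inr X) (inl (bprefix X n)).
Proof.
by move=> i lin /=; rewrite (onth_word _ (X 0)) /= ?size_mkseq ?nth_mkseq.
Qed.

Lemma size_rcat (u v : seq (letter A)) :
  (size (rcat u v) <= size u + size v)%N.
Proof.
elim: u => //= x u; set w := rcat u v; case: w => [|y w] /=; first by lia.
by case: ifP => _ /=; lia.
Qed.

Lemma size_mulg u v : (size (u * v)%g <= size u + size v)%N.
Proof. exact: size_rcat. Qed.

Lemma fg_cons x (u : seq (letter A)) (ru : reduced (x :: u)) :
  FreeGroup ru = fg_letter x * FreeGroup (path_sorted ru).
Proof.
apply: val_inj => /=; case: u ru => [|y u] ru //=.
by case/andP: (ru) => /negbTE-> _.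
Qed.

Lemma lipschitz (phi : {multiplicative freeGroup A -> freeGroup A}) :
  exists K, forall w, (size (phi w) <= K * size w)%N.
Proof.
have phi1 : phi 1 = 1.
  by apply: (@mulgI _ (phi 1)); rewrite -gmulfM !mulg1.
exists (\max_(x : letter A) size (phi (fg_letter x))).
set K := \max_(x : letter A) _.
case=> w; elim: w => [|x w IHw] rw.
  by have -> : FreeGroup rw = 1 by [apply: val_inj]; rewrite phi1.
rewrite [X in phi X]fg_cons gmulfM (leq_trans (size_mulg _ _)) //=.
rewrite mulnS leq_add ?IHw //.
exact: (leq_bigmax (F := fun x => size (phi (fg_letter x))) x).
Qed.

Lemma agree_mul_letter u x :
  agree (size u).-1 (inl u) (inl (u * fg_letter x)).
Proof.
case: u; elim/last_ind => [|u y _] ru i //=; rewrite size_rcons /= => iu.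
have r_uy : reduced u by move: ru; rewrite /reduced -cats1 => /cat_sorted2[].
rewrite {1}onthE -cats1 map_cat nth_cat size_map iu.
have -> : rcat (u ++ [:: y]) [:: x] = rcat u (rcons_letter y [:: x]).
  by rewrite /rcat foldr_cat.
rewrite /=; case: ifPn => [_|nxy].
  by rewrite rcat_reduced cats0 // onthE.
rewrite rcat_reduced; first by rewrite onthE map_cat nth_cat size_map iu.
move: ru nxy; rewrite /reduced -cats1.
case: u {iu r_uy} => [|z u] /=; first by rewrite andbT.
by rewrite !cat_path /= !andbT => /andP[-> ->].
Qed.

Lemma agree_mul u v :
  agree (size u - size v)%N (inl u) (inl (u * v)).
Proof.
case: v => v rv; elim: v rv u => [|x v IHv] rv u.
  have -> : FreeGroup rv = 1 by apply: val_inj.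
  by rewrite mulg1.
rewrite [X in u * X]fg_cons mulgA /=; have r_v := path_sorted rv.
have su : (size u <= size (u * fg_letter x)%g + 1)%N.
  rewrite -{1}[u](mulgK (fg_letter x)) (leq_trans (size_mulg _ _)) //.
apply: (agree_trans (y := inl (u * fg_letter x))).
  by apply: (agree_leq _ (@agree_mul_letter u x)) => /=; lia.
by apply: (agree_leq _ (IHv _ _)); move: su => /=; lia.
Qed.

(* Words extending a long prefix of X are mapped to words that agree. *)
Lemma aut_agree (phi : automorphism A) X k : exists N, forall w n,
  (N <= n)%N -> agree n (inr X) (inl w) ->
  agree k (inl (phi (bprefix X N))) (inl (phi w)) /\ (k <= size (phi w))%N.
Proof.
have [L phiL] := lipschitz phi.
have phiVM : {morph aut_inv phi : u v / u * v}.
  by move=> u v; apply: (can_inj (autK phi)); rewrite gmulfM !aut_invK.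
pose psiM := isMultiplicative.Build _ _ (aut_inv phi) phiVM.
pose psi : {multiplicative freeGroup A -> freeGroup A} :=
  HB.pack (aut_inv phi) psiM.
have [K psiK] := lipschitz psi.
have le_phi w : (size w <= K * size (phi w))%N.
  by rewrite -{1}[w](autK phi); apply: psiK.
pose N := (K * (k + L)).+1; exists N => w n Nn Xw.
have {n Nn} Xw : agree N (inr X) (inl w) by apply: (agree_leq Nn).
have Nw : (N <= size w)%N.
  rewrite leqNgt; apply/negP => wN; have := Xw _ wN.
  by rewrite /= onthE nth_default // size_map.
have def_take : take N w = mkseq X N.
  apply: (@eq_from_nth _ (X 0)); first by rewrite size_mkseq size_takel.
  move=> i; rewrite size_takel // => iN; have := Xw _ iN.
  by rewrite /= nth_mkseq // nth_take // (onth_word _ (X 0)) ?(leq_trans iN)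
    // => -[].
split; last first.
  have := leq_trans Nw (le_phi w); rewrite /N => lt.
  by have := ltn_mul2l K (k + L) (size (phi w)); rewrite lt => /esym/andP[_]; lia.
suff H m : (N <= m <= size w)%N -> forall rw : reduced (take m w),
    agree k (inl (phi (bprefix X N))) (inl (phi (FreeGroup rw))).
  have rw : reduced (take (size w) w) by rewrite take_size wordP.
  have -> : w = FreeGroup rw by apply: val_inj; rewrite /= take_size.
  by apply: H; rewrite Nw leqnn.
elim: m => [|m IHm] /andP[]; first by lia.
rewrite leq_eqVlt => /orP[/eqP eN|Nm mw rw].
  move=> _ rw; suff -> : FreeGroup rw = bprefix X N by [].
  by apply: val_inj; rewrite /= -def_take eN.
have x0 : letter A := X 0.
have eq_take : take m.+1 w = rcons (take m w) (nth x0 w m).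
  exact: take_nth.
have rm : reduced (take m w) by apply: take_sorted; apply: wordP.
have -> : FreeGroup rw = FreeGroup rm * fg_letter (nth x0 w m).
  apply: val_inj; rewrite /= eq_take -cats1 rcat_reduced //.
  by rewrite cats1 -eq_take.
rewrite gmulfM; apply: agree_trans (IHm _ rm) _; first by lia.
apply: (agree_leq _ (@agree_mul _ _)).
have := le_phi (FreeGroup rm); have := phiL (fg_letter (nth x0 w m)).
rewrite /= size_takel ?(ltnW mw) // muln1 => h1 h2.
have lt : (K * (k + L) < K * size (phi (FreeGroup rm)))%N.
  by apply: leq_trans h2; exact: Nm.
by have := ltn_mul2l K (k + L) (size (phi (FreeGroup rm))); rewrite lt => /esym/andP[_]; lia.
Qed.

Lemma aut_limit (phi : automorphism A) X : exists Y, forall k, exists N,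
  forall w, agree N (inr X) (inl w) -> agree k (inr Y) (inl (phi w)).
Proof.
have /choice[N NP] := aut_agree phi X.
have prefP k n : (N k <= n)%N ->
    agree k (inl (phi (bprefix X (N k)))) (inl (phi (bprefix X n))) /\
    (k <= size (phi (bprefix X n)))%N.
  by move=> kn; apply: (NP k _ n) => //; apply: agree_bprefix.
pose p k := phi (bprefix X (N k)).
have pP i k l : (i < k)%N -> (i < l)%N -> onth (p k) i = onth (p l) i.
  move=> ik il; pose n := maxn (N k) (N l).
  have [pk _] := prefP k n (leq_maxl _ _).
  have [pl _] := prefP l n (leq_maxr _ _).
  by have /= -> := pk i ik; have /= -> := pl i il.
have sp k : (k <= size (p k))%N by case: (prefP k (N k) (leqnn _)).
pose y i := nth (X 0) (p i.+1) i.
have yP i k : (i < k)%N -> onth (p k) i = Some (y i).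
  by move=> ik; rewrite (pP i k i.+1) // (onth_word _ (X 0)).
have y_red i : y i.+1 != linv (y i).
  have /(sortedP (X 0))/(_ i (sp i.+2)) := wordP (p i.+2).
  have := yP i i.+2 (ltnW (ltnSn _)); have := yP i.+1 i.+2 (ltnSn _).
  rewrite !(onth_word _ (X 0)) ?sp //; last by apply: leq_trans (sp i.+2).
  by move=> _ [->].
exists (Boundary y_red) => k; exists (N k) => w Xw i ik /=.
by have [/(_ i ik)/= <- _] := NP k w _ (leqnn _) Xw; rewrite yP.
Qed.

Lemma ex_continuous_extension (phi : automorphism A) :
  exists g, continuous_extension phi g.
Proof.
have /choice[g gP] := aut_limit phi; exists g => X k.
have [N NP] := gP X k; exists N => -[w|X'] /= XX'; first exact: NP.
have [N' N'P] := gP X' k; pose n := maxn N N'.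
have X'w := @agree_bprefix X' n.
apply: (agree_trans (y := inl (phi (bprefix X' n)))).
  apply: NP; apply: agree_trans XX' _.
  by apply: agree_leq X'w; apply: leq_maxl.
apply: agree_sym; apply: N'P.
by apply: agree_leq X'w; apply: leq_maxr.
Qed.

Lemma continuous_extension_unique (phi : freeGroup A -> freeGroup A) g h :
  continuous_extension phi g -> continuous_extension phi h -> g = h.
Proof.
move=> gP hP; apply/funext => X; apply: boundary_inj => i.
have [N NP] := gP X i.+1; have [M MP] := hP X i.+1; pose n := maxn N M.
have Xw := @agree_bprefix X n.
have /= g_w := NP _ (agree_leq (leq_maxl _ _) Xw) i (ltnSn i).
have /= h_w := MP _ (agree_leq (leq_maxr _ _) Xw) i (ltnSn i).
by move: h_w; rewrite -g_w => -[].
Qed.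

End BoundaryMap.

Definition boundary_map (A : finType) (phi : automorphism A) :
    boundary A -> boundary A :=
  sval (cid (ex_continuous_extension phi)).

Definition boundary_map2 (A : finType) (phi : automorphism A)
    (XY : boundary A * boundary A) : boundary A * boundary A :=
  (boundary_map phi XY.1, boundary_map phi XY.2).

Lemma boundary_mapP (A : finType) (phi : automorphism A) :
  continuous_extension phi (boundary_map phi).
Proof. exact: svalP (cid (ex_continuous_extension phi)). Qed.

(* Biinfinite paths of the Cayley graph with respect to A, whose edges join g
   to g * x for x in A or A^-1. Of the parametrizations of gamma(X, Y) by the
   integers, which differ by translations, none is singled out. *)

Definition edge (A : finType) (g h : freeGroup A) : Prop :=
  exists x : letter A, h = g * fg_letter x.

Definition biinfinite_reduced_path (A : finType) (p : int -> freeGroup A) :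
    Prop :=
  (forall i : int, edge (p i) (p (i + 1)%R)) /\
  (forall i : int, p (i + 1)%R <> p (i - 1)%R).

Definition is_gamma (A : finType) (X Y : boundary A)
    (p : int -> freeGroup A) : Prop :=
  [/\ biinfinite_reduced_path p,
      converges_to (fun n : nat => p (- Posz n)%R) X &
      converges_to (fun n : nat => p (Posz n)) Y].

Definition double_boundary (A : finType) : set (boundary A * boundary A) :=
  [set XY | XY.1 <> XY.2].

Definition double_cylinder (A : finType) (u v : freeGroup A) :
    set (boundary A * boundary A) :=
  [set XY | double_boundary XY /\
    exists2 p, is_gamma XY.1 XY.2 p &
      exists i j : int, [/\ (i <= j)%R, p i = u & p j = v]].

(* Double cylinders are only considered for pairs of distinct elements, so
   that U and V are required to be disjoint. *)
Definition is_decomposition (A : finType) (phi : automorphism A)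
    (u v : freeGroup A) (U V : set (freeGroup A)) : Prop :=
  [/\ finite_set U, finite_set V,
      (forall u' v', U u' -> V v' -> u' <> v'),
      boundary_map2 phi @` double_cylinder u v =
        \bigcup_(uv in U `*` V) double_cylinder uv.1 uv.2 &
      trivIset (U `*` V) (fun uv => double_cylinder uv.1 uv.2)].

(* Algorithms: programs of the WHILE language over binary trees (N. D. Jones,
   Computability and Complexity, MIT Press 1997), which computes exactly the
   partial recursive functions. The input is the initial value of variable 0,
   all other variables being initially Leaf, and the output is its final
   value. *)

Inductive tree : Type := Leaf | Node of tree & tree.

Fixpoint tree_eqb (s t : tree) : bool :=
  match s, t with
  | Leaf, Leaf => true
  | Node s1 s2, Node t1 t2 => tree_eqb s1 t1 && tree_eqb s2 t2
  | _, _ => false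
  end.

Definition tree_of_bool (b : bool) : tree := if b then Node Leaf Leaf else Leaf.

Inductive expr : Type :=
  | EVar of nat
  | ELeaf
  | ENode of expr & expr
  | EHead of expr
  | ETail of expr
  | EEq of expr & expr.

Inductive command : Type :=
  | Assign of nat & expr
  | Seq of command & command
  | While of expr & command.

Definition store : Type := nat -> tree.

Fixpoint eval (s : store) (e : expr) : tree :=
  match e with
  | EVar n => s n
  | ELeaf => Leaf
  | ENode e1 e2 => Node (eval s e1) (eval s e2)
  | EHead e1 => if eval s e1 is Node t _ then t else Leaf
  | ETail e1 => if eval s e1 is Node _ t then t else Leaf
  | EEq e1 e2 => tree_of_bool (tree_eqb (eval s e1) (eval s e2))
  end.

Definition update (s : store) (n : nat) (t : tree) : store :=
  fun m => if m == n then t else s m.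

Inductive exec : command -> store -> store -> Prop :=
  | exec_assign n e s : exec (Assign n e) s (update s n (eval s e))
  | exec_seq c1 c2 s1 s2 s3 :
      exec c1 s1 s2 -> exec c2 s2 s3 -> exec (Seq c1 c2) s1 s3
  | exec_while_false e c s : eval s e = Leaf -> exec (While e c) s s
  | exec_while_true e c s1 s2 s3 :
      eval s1 e <> Leaf -> exec c s1 s2 -> exec (While e c) s2 s3 ->
      exec (While e c) s1 s3.

Definition computes (c : command) (input output : tree) : Prop :=
  exists2 s, exec c (update (fun=> Leaf) 0 input) s & s 0 = output.

Lemma exec_deterministic c s s1 s2 : exec c s s1 -> exec c s s2 -> s1 = s2.
Proof.
move=> h; elim: h s2 => {c s s1}.
- by move=> n e s s2 h; inversion h.
- move=> c1 c2 s1 s2 s3 _ IH1 _ IH2 s4 h; inversion h; subst.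
  by apply: IH2; rewrite (IH1 s5).
- by move=> e c s es s2 h; inversion h.
- move=> e c s1 s2 s3 es _ IH1 _ IH2 s4 h; inversion h; subst => //.
  by apply: IH2; rewrite (IH1 s5).
Qed.

Fixpoint tree_of_nat (n : nat) : tree :=
  if n is n'.+1 then Node Leaf (tree_of_nat n') else Leaf.

Definition tree_of_seq (T : Type) (enc : T -> tree) (s : seq T) : tree :=
  foldr (fun x t => Node (enc x) t) Leaf s.

Definition tree_of_letter (A : finType) (x : letter A) : tree :=
  Node (tree_of_nat (enum_rank x.1)) (tree_of_bool x.2).

Definition tree_of_word (A : finType) (w : freeGroup A) : tree :=
  tree_of_seq (@tree_of_letter A) w.

Definition tree_of_words (A : finType) (ws : seq (freeGroup A)) : tree :=
  tree_of_seq (@tree_of_word A) ws.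

Definition algorithm_input (A : finType) (phi : automorphism A)
    (u v : freeGroup A) : tree :=
  Node (Node (tree_of_word u) (tree_of_word v))
    (Node (tree_of_words [seq phi (fg_gen a) | a <- enum A])
          (tree_of_words [seq aut_inv phi (fg_gen a) | a <- enum A])).

Definition algorithm_output (A : finType) (us vs : seq (freeGroup A)) : tree :=
  Node (tree_of_words us) (tree_of_words vs).

(* Main.v *)
From HB Require Import structures.
Require Import Defs.
From mathcomp Require Import all_boot all_order all_algebra.
From mathcomp Require Import boolp classical_sets cardinality zify.

(* A double cylinder C2[u,v] is the product of two shadows: X lies in the
   shadow of u seen from v, and Y in that of v seen from u; whether an end lies
   in such a shadow is decided by any long enough prefix of it. The first k
   letters of the image of an end Z under the inverse of phi are those of the
   image of the prefix of Z of length L, as soon as L > K (k + M), where K and M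
   are Lipschitz constants of phi and of its inverse. So the image of C2[u,v]
   consists of the (X, Y) whose prefixes of length L belong to two explicit
   disjoint finite sets U and V of words of length L; and for distinct words
   u', v' of the same length, C2[u',v'] is the set of the (X, Y) where X starts
   with u' and Y with v'. The algorithm lists all words of length L, and keeps
   those whose images satisfy the finite criterion. *)

Set Implicit Arguments.
Unset Strict Implicit.
Unset Printing Implicit Defensive.

Local Open Scope classical_set_scope.
Local Open Scope group_scope.

(** * Geodesics in the Cayley tree *)

Section Geometry.
Variable A : finType.
Implicit Types (x y : letter A) (r s t : seq (letter A)).
Implicit Types (a b u v w z : freeGroup A) (X Y Z : boundary A).

(** Reducedness constrains only adjacent letters, and a nonempty [t] keeps the letters of [s] apart
    from those of [r]. *)
Lemma reduced_cat3 s t r : t != [::] ->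
  reduced (s ++ t ++ r) = reduced (s ++ t) && reduced (t ++ r).
Proof.
case: t => // y t _; rewrite /reduced.
by case: s => [|x s] /=; rewrite !cat_path /= ?cat_path; do ![case: path => //=];
  case: (_ != _).
Qed.

Lemma reduced_catl s t : reduced (s ++ t) -> reduced s.
Proof. by case/cat_sorted2. Qed.

Lemma reduced_catr s t : reduced (s ++ t) -> reduced t.
Proof. by case/cat_sorted2. Qed.

Lemma word_mul u v : reduced (word u ++ word v) ->
  word (u * v) = word u ++ word v.
Proof. exact: rcat_reduced. Qed.

Lemma reduced_rinvE s : reduced (rinv s) = reduced s.
Proof.
by apply/idP/idP => [/reduced_rinv|/reduced_rinv //]; rewrite rinvK.
Qed.

Lemma rinv_cat s t : rinv (s ++ t) = rinv t ++ rinv s.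
Proof. by rewrite /rinv map_cat rev_cat. Qed.

Lemma rcat_catl s t r : rcat (s ++ t) r = rcat s (rcat t r).
Proof. exact: foldr_cat. Qed.

(** Each letter of [s] cancels at most one letter of [t], so the cancellation never reaches [r]. *)
Lemma rcat_cat s t r : (size s <= size t)%N -> rcat s (t ++ r) = rcat s t ++ r.
Proof.
elim: s => //= x s IHs lt_st; rewrite IHs ?(ltnW lt_st) //.
(* As one letter of the left factor is still to be prepended, this bound keeps [rcat s t] nonempty,
   so that this letter does not meet [r]. *)
have : (size t <= size (rcat s t) + size s)%N.
  elim: s {IHs lt_st} => [|y s IHs] /=; first by lia.
  by case: (rcat s t) IHs => [|z w] /=; [lia | case: ifP => /=; lia].
by case: (rcat s t) => [|y w] //=; [lia | case: ifP].
Qed.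

(* b lies on the geodesic from a to c in the Cayley tree. *)
Definition between a b (c : freeGroup A) : bool :=
  reduced (word (a^-1 * b) ++ word (b^-1 * c)).

Lemma between_sym a b c : between a b c = between c b a.
Proof.
have rinv_word w : rinv (word w) = word w^-1 by [].
by rewrite /between -reduced_rinvE rinv_cat !rinv_word !invgM !invgK.
Qed.

Lemma word_between a b c : between a b c ->
  word (a^-1 * c) = word (a^-1 * b) ++ word (b^-1 * c).
Proof. by move=> /word_mul <-; rewrite mulgA -(mulgA _ b) mulgV mulg1. Qed.

(** As [z] is longer than [b], the word of [b^-1 * z] is nonempty; appending [t] to it leaves its
    junction with [a^-1 * b] unchanged. *)
Lemma between_cat a b z z' t : word z' = word z ++ t -> (size b < size z)%N ->
  between a b z' = between a b z.
Proof.
move=> def_z' lt_bz.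
have size_b : size (word b^-1) = size b by rewrite /= size_rev size_map.
have def_bz' : word (b^-1 * z') = word (b^-1 * z) ++ t.
  by rewrite /= def_z' rcat_cat // /rinv size_rev size_map ltnW.
rewrite /between def_bz' reduced_cat3 -?def_bz' ?wordP ?andbT //.
apply: contraTneq lt_bz => bz1; rewrite -leqNgt.
suff -> : z = b by [].
by apply: (mulgI b^-1); rewrite mulVg; apply: val_inj.
Qed.

(** Each hypothesis makes lengths add up along a geodesic; the sum of the two identities forces the
    distance between [a] and [b] to vanish. *)
Lemma between_antisym a b c : between a b c -> between b a c -> a = b.
Proof.
move=> /word_between/(congr1 size) + /word_between/(congr1 size).
rewrite !size_cat => h1 h2; have /nilP ba1 : size (word (b^-1 * a)) == 0.
  by apply/eqP; lia.
by apply: (mulgI b^-1); rewrite mulVg; apply: val_inj.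
Qed.

Lemma word_fork s t : size s = size t -> s <> t -> exists r x s' y t',
  [/\ s = r ++ x :: s', t = r ++ y :: t' & x <> y].
Proof.
elim: s t => [|x s IHs] [|y t] //= [st] nst.
have [exy|nxy] := eqVneq x y; last first.
  by exists [::], x, s, y, t; split=> //; apply/eqP.
have [|r [x' [s' [y' [t' [-> -> nxy']]]]]] := IHs t st; first by congruence.
by exists (x :: r), x', s', y', t'; rewrite exy.
Qed.

(** Words of equal length leave their common prefix [r] by distinct letters, so [a^-1 * b] ends in
    the nonempty suffix [y :: t] of [b]. Hence [b^-1 * z] cancels against [a^-1 * b] exactly when it
    cancels against [b] itself. *)
Lemma between_prefix a b z : size a = size b -> a <> b ->
  between a b z = prefix (word b) (word z).
Proof.
move=> sab nab.
have [|r [x [s [y [t [def_a def_b nxy]]]]]] := word_fork sab.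
  by move=> /val_inj.
have def_ab : word (a^-1 * b) = rinv (x :: s) ++ y :: t.
  have rst : reduced (rinv (x :: s) ++ y :: t).
    have def_xs : rinv (x :: s) = rinv s ++ [:: linv x].
      by rewrite /rinv /= rev_cons cats1.
    rewrite def_xs -catA reduced_cat3 // -def_xs reduced_rinvE.
    have := wordP a; rewrite def_a => /reduced_catr->.
    have := wordP b; rewrite def_b => /reduced_catr; rewrite /reduced /= => ->.
    by rewrite linvK andbT eq_sym; apply/eqP.
  rewrite -[RHS]rcat_reduced // /= def_a def_b rinv_cat.
  rewrite rcat_catl; congr rcat.
  rewrite -rcat_reduced; last by rewrite -def_b wordP.
  have := wordP b; rewrite def_b => rb.
  by rewrite -rcatA ?rcat_invl ?(reduced_catl rb) ?(reduced_catr rb).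
have def_z : word z = rcat (word b) (word (b^-1 * z)).
  by rewrite -[LHS]/(word (1 * z)) -(mulgV b) -mulgA.
rewrite /between def_ab -catA reduced_cat3 // -def_ab wordP andTb.
apply/idP/idP => [rtz|].
  rewrite def_z rcat_reduced ?prefix_prefix // def_b -catA.
  by rewrite reduced_cat3 // -def_b wordP.
case/prefixP=> q zbq.
have -> : word (b^-1 * z) = q.
  have := wordP z; rewrite zbq => rbq.
  by rewrite /= zbq -rcat_reduced // -rcatA ?rcat_invl ?(reduced_catr rbq) ?wordP.
by have := wordP z; rewrite zbq def_b -catA => /reduced_catr.
Qed.

(** The letters [x i] label the edges. Absence of backtracking means that consecutive labels are
    never inverse to each other, so words of labels are already reduced. *)
Lemma path_letters p : biinfinite_reduced_path p -> exists x : int -> letter A,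
  forall i n, word ((p i)^-1 * p (i + Posz n)%R) =
              mkseq (fun k => x (i + Posz k)%R) n.
Proof.
case=> /choice[x px] nback.
exists x => i; elim=> [|n IHn]; first by rewrite GRing.addr0 mulVg.
have x_red j : x (j + 1)%R != linv (x j).
  apply/eqP => ex; apply: (nback (j + 1)%R); rewrite GRing.addrK px ex px.
  rewrite -mulgA; have -> : fg_letter (x j) * fg_letter (linv (x j)) = 1.
    by apply: val_inj; rewrite /= eqxx.
  by rewrite mulg1.
have : reduced (mkseq (fun k => x (i + Posz k)%R) n.+1).
  apply/(sortedP (x i)) => k; rewrite size_mkseq => lt_kn.
  rewrite !nth_mkseq ?(ltnW lt_kn) //.
  by have -> : (i + Posz k.+1 = i + Posz k + 1)%R by lia.
rewrite mkseqS -cats1 -IHn => rx.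
have -> : (i + Posz n.+1 = i + Posz n + 1)%R by lia.
by rewrite px mulgA word_mul.
Qed.

Lemma path_between p i j k : biinfinite_reduced_path p ->
  (i <= j)%R -> (j <= k)%R -> between (p i) (p j) (p k).
Proof.
move=> /path_letters[x px] ij jk.
have [m [n [-> ->]]] : exists m n,
    j = (i + Posz m)%R /\ k = (i + Posz m + Posz n)%R.
  by exists `|j - i|%N, `|k - j|%N; split; lia.
rewrite /between !px.
have -> : mkseq (fun k => x (i + Posz m + Posz k)%R) n =
          [seq x (i + Posz k)%R | k <- iota m n].
  rewrite /mkseq -[m in RHS]addn0 iotaDl -map_comp; apply: eq_map => l /=.
  by congr (x _); lia.
by rewrite -map_cat -iotaD -/(mkseq _ _) -px wordP.
Qed.

Lemma bprefixD X m n :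
  word (bprefix X (m + n)) = word (bprefix X m) ++ [seq X i | i <- iota m n].
Proof. by rewrite /= /mkseq iotaD map_cat. Qed.

Lemma bprefixS X n : bprefix X n.+1 = bprefix X n * fg_letter (X n).
Proof.
apply: val_inj; rewrite -[RHS]/(rcat (mkseq X n) [:: X n]).
by rewrite rcat_reduced cats1 -mkseqS // reduced_mkseq.
Qed.

Lemma size_bprefix X n : size (bprefix X n) = n.
Proof. exact: size_mkseq. Qed.

Lemma bprefix_eq X Y n : (forall i, (i < n)%N -> X i = Y i) ->
  bprefix X n = bprefix Y n.
Proof.
move=> XY; apply: val_inj; apply: (@eq_from_nth _ (X 0)); rewrite !size_mkseq //.
by move=> i lt_in; rewrite !nth_mkseq ?XY.
Qed.

Lemma agree_prefix k X w : agree k (inr X) (inl w) ->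
  exists t, word w = word (bprefix X k) ++ t.
Proof.
move=> Xw; exists (drop k w).
have le_kw : (k <= size w)%N.
  rewrite leqNgt; apply/negP => lt_wk; have := Xw _ lt_wk.
  by rewrite /= onthE nth_default // size_map.
rewrite -{1}[word w](cat_take_drop k) -[word (bprefix X k)]/(mkseq X k); congr cat.
apply: (@eq_from_nth _ (X 0)); first by rewrite size_mkseq size_takel.
move=> i; rewrite size_takel // => lt_ik; have := Xw _ lt_ik.
by rewrite /= nth_mkseq // nth_take //
  (onth_word (leq_trans lt_ik le_kw) (X 0)) => -[].
Qed.

(** With [c] the length of the longest common prefix of the two ends, the branching vertex sits at
    time 0. [Negz n] stands for -(n+1), whence [n.+1]. *)
Definition fork_path X Y (c : nat) (i : int) : freeGroup A :=
  match i with
  | Posz n => bprefix Y (c + n)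
  | Negz n => bprefix X (c + n.+1)
  end.

(** Backtracking is excluded at time 0 by [X c <> Y c], and at other times by length: the vertices
    just before and just after differ in length by 2. *)
Lemma is_gamma_fork X Y (c : nat) : 
  (forall i, (i < c)%N -> X i = Y i) -> X c <> Y c ->
  is_gamma X Y (fork_path X Y c).
Proof.
move=> eqXY neqXY; have edgeX n : edge (bprefix X n.+1) (bprefix X n).
  exists (linv (X n)); rewrite bprefixS -mulgA.
  suff -> : fg_letter (X n) * fg_letter (linv (X n)) = 1 by rewrite mulg1.
  by apply: val_inj; rewrite /= eqxx.
split; first split.
- case=> [n|[|n]].
  + have -> : (Posz n + 1 = Posz n.+1)%R by lia.
    by exists (Y (c + n)%N); rewrite /= addnS bprefixS.
  + have -> : (Negz 0 + 1 = Posz 0)%R by lia.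
    by rewrite /= addn0 addn1 -(bprefix_eq eqXY); apply: edgeX.
  + have -> : (Negz n.+1 + 1 = Negz n)%R by lia.
    by rewrite /= [in X in edge X _]addnS; apply: edgeX.
- case=> [[|n]|[|n]].
  + have -> : (Posz 0 + 1 = Posz 1)%R by lia.
    have -> : (Posz 0 - 1 = Negz 0)%R by lia.
    rewrite /= addn1 !bprefixS (bprefix_eq eqXY) => /mulgI[eYX].
    by apply: neqXY; rewrite eYX.
  + have -> : (Posz n.+1 + 1 = Posz n.+2)%R by lia.
    have -> : (Posz n.+1 - 1 = Posz n)%R by lia.
    by move=> /(congr1 (fun w : freeGroup A => size w));
      rewrite /= !size_mkseq; lia.
  + have -> : (Negz 0 + 1 = Posz 0)%R by lia.
    have -> : (Negz 0 - 1 = Negz 1)%R by lia.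
    by move=> /(congr1 (fun w : freeGroup A => size w));
      rewrite /= !size_mkseq; lia.
  + have -> : (Negz n.+1 + 1 = Negz n)%R by lia.
    have -> : (Negz n.+1 - 1 = Negz n.+2)%R by lia.
    by move=> /(congr1 (fun w : freeGroup A => size w));
      rewrite /= !size_mkseq; lia.
- move=> k; exists k => -[|n] le_kn.
    have -> : (- Posz 0 = Posz 0)%R by lia.
    by move=> i; lia.
  have -> : (- Posz n.+1 = Negz n)%R by lia.
  apply: (agree_leq _ (@agree_bprefix _ X _)); lia.
- move=> k; exists k => n le_kn.
  apply: (agree_leq _ (@agree_bprefix _ Y _)); lia.
Qed.

(* The ends X such that the geodesic from v to X passes through u. *)
Definition shadow v u : set (boundary A) :=
  [set X | between v u (bprefix X (size u).+1)].

Lemma shadowP v u X w n : agree n (inr X) (inl w) -> (size u < n)%N ->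
  (X \in shadow v u) = between v u w.
Proof.
move=> Xw lt_un.
have [t def_w] := agree_prefix (agree_leq lt_un Xw).
rewrite (between_cat _ def_w) ?size_bprefix //.
by apply/idP/idP; rewrite in_setE.
Qed.

(** From left to right, far vertices of the path stand for long prefixes of the ends. Conversely,
    the two shadow conditions glue along the nonempty segment from [u] to [v] into one reduced word;
    it is the word of labels of [fork_path], which therefore visits [u] and then [v]. *)
Lemma double_cylinderP u v X Y : u <> v ->
  double_cylinder u v (X, Y) <-> shadow v u X /\ shadow u v Y.
Proof.
move=> neq_uv; rewrite -[shadow v u X]in_setE -[shadow u v Y]in_setE; split.
  case=> _ [p [pP cvX cvY] [i [j [le_ij def_u def_v]]]].
  have [M XM] := cvX (size u).+1; have [N YN] := cvY (size v).+1; split.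
    (* Adding the absolute value of [i] ensures that time -m comes no later than time [i], where the
       path is at [u]. *)
    pose m := (M + `|i|)%N.
    rewrite (@shadowP _ _ _ (p (- Posz m)%R) (size u).+1) //; last first.
      by apply: XM; lia.
    by rewrite between_sym -def_u -def_v path_between //; lia.
  pose m := (N + `|j|)%N.
  rewrite (@shadowP _ _ _ (p (Posz m)%R) (size v).+1) //; last first.
    by apply: YN; lia.
  by rewrite -def_u -def_v path_between //; lia.
pose n0 := maxn (size u).+1 (size v).+1.
have shX n : (n0 <= n)%N -> X \in shadow v u = between v u (bprefix X n).
  by move=> le_n; apply: (@shadowP _ _ _ _ n); [apply: agree_bprefix | lia].
have shY n : (n0 <= n)%N -> Y \in shadow u v = between u v (bprefix Y n).
  by move=> le_n; apply: (@shadowP _ _ _ _ n); [apply: agree_bprefix | lia].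
case=> Xu Yv.
(* If the ends were equal, one far vertex would have [u] on its geodesic from [v] and [v] on its
   geodesic from [u], forcing [u = v]. *)
have neqXY : exists c, X c != Y c.
  apply: contrapT => eqXY; apply: neq_uv; apply/esym.
  apply: (@between_antisym _ _ (bprefix X n0)); first by rewrite -shX.
  have -> : X = Y; last by rewrite -shY.
  apply: boundary_inj => c; apply/eqP/negPn/negP => neqc.
  by apply: eqXY; exists c.
have [c neqc minc] := ex_minnP neqXY.
have eqXY i : (i < c)%N -> X i = Y i.
  by move=> lt_ic; apply/eqP; apply: contraLR lt_ic => /minc; rewrite -leqNgt.
have gammaXY := is_gamma_fork eqXY (elimN eqP neqc).
split.
  by move=> /= eXY; rewrite eXY eqxx in neqc.
exists (fork_path X Y c) => //; have [pathp _ _] := gammaXY.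
(* This length exceeds both the fork [c] and the threshold [n0], so the path reaches prefixes of
   length [n], long enough to decide both shadows, at times -(n-c) and n-c. *)
pose n := (c + n0).+1; pose p := fork_path X Y c.
have pX : p (- Posz (n - c))%R = bprefix X n.
  have -> : (- Posz (n - c) = Negz n0)%R by lia.
  by rewrite /p /=; congr (bprefix X _); lia.
have pY : p (Posz (n - c)) = bprefix Y n.
  by rewrite /p /=; congr (bprefix Y _); lia.
have [x px] := path_letters pathp.
have [rX rY] : between (bprefix X n) u v /\ between u v (bprefix Y n).
  by rewrite between_sym -shX -?shY //; lia.
have glue : reduced (word ((bprefix X n)^-1 * u) ++ word (u^-1 * v) ++
                     word (v^-1 * bprefix Y n)).
  rewrite reduced_cat3 ?[X in X && _]rX //; apply/negP => /eqP uv1.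
  by apply: neq_uv; apply: (mulgI u^-1); rewrite mulVg; apply/esym/val_inj.
(* If the label word starts with the word leading to [a], the path is at [a] after as many steps as
   that word has letters. *)
have locate a t :
    word ((bprefix X n)^-1 * bprefix Y n) = word ((bprefix X n)^-1 * a) ++ t ->
    p (- Posz (n - c) + Posz (size (word ((bprefix X n)^-1 * a)%g)))%R = a.
  set s := word (_^-1 * a) => def_st; set k := size s.
  apply: (mulgI (bprefix X n)^-1); apply: val_inj; rewrite -[RHS]/s -pX.
  rewrite [LHS]px; move: def_st; rewrite -pX.
  have -> : bprefix Y n = p (- Posz (n - c) + Posz ((n - c) + (n - c)))%R.
    by rewrite -pY; congr p; lia.
  rewrite px; set m := (_ + _)%N => def_st.
  have /(congr1 size) := def_st; rewrite size_cat size_mkseq => def_m.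
  have /(congr1 (take k)) := def_st; rewrite take_size_cat // => <-.
  by rewrite -map_take take_iota (minn_idPl _) // def_m leq_addr.
have uvX := word_between rX.
exists (- Posz (n - c) + Posz (size (word ((bprefix X n)^-1 * u)%g)))%R.
exists (- Posz (n - c) + Posz (size (word ((bprefix X n)^-1 * v)%g)))%R.
have def_XY : word ((bprefix X n)^-1 * bprefix Y n) =
    word ((bprefix X n)^-1 * u) ++ word (u^-1 * v) ++ word (v^-1 * bprefix Y n).
  rewrite -(rcat_reduced glue) -(word_between rY).
  by rewrite -[RHS]/(word (_ * _)) mulgA -(mulgA _ u) mulgV mulg1.
split; [|exact: locate def_XY|].
  by rewrite uvX size_cat; lia.
by apply: (locate v (word (v^-1 * bprefix Y n))); rewrite uvX -catA.
Qed.
End Geometry.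

(** * Action of an automorphism on the boundary *)

Section Automorphisms.
Variable A : finType.
Implicit Types (phi : automorphism A) (u v w : freeGroup A) (X Y : boundary A).

Lemma aut_invM phi : {morph aut_inv phi : u v / u * v}.
Proof. exact: can2_gmulfM (@autK _ phi) (@aut_invK _ phi). Qed.

Definition inverse_aut phi : automorphism A :=
  @Automorphism A
    (HB.pack (aut_inv phi)
      (isMultiplicative.Build _ _ (aut_inv phi) (@aut_invM phi)))
    phi (aut_invK phi) (autK phi).

Lemma inverse_autE phi w : inverse_aut phi w = aut_inv phi w.
Proof. by []. Qed.

(** The composite extends the identity map of the free group continuously, and such an extension is
    unique. *)
Lemma boundary_map_comp phi (psi : automorphism A) : cancel psi phi ->
  cancel (boundary_map psi) (boundary_map phi).
Proof.
move=> psiK X; suff : boundary_map phi \o boundary_map psi = id.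
  by move=> /(congr1 (fun g => g X)).
apply: (@continuous_extension_unique _ id); last first.
  by move=> Z k; exists k => -[].
move=> Z k; have [N phiN] := boundary_mapP phi (boundary_map psi Z) k.
have [N' psiN] := boundary_mapP psi Z N; exists N' => y /psiN /phiN.
by case: y => //= w; rewrite psiK.
Qed.

Lemma aut1 phi : phi 1 = 1.
Proof. by apply: (@mulgI _ (phi 1)); rewrite -gmulfM !mulg1. Qed.

Lemma autV phi w : phi w^-1 = (phi w)^-1.
Proof. by apply: (@mulgI _ (phi w)); rewrite -gmulfM !mulgV aut1. Qed.

Lemma size_aut_letter phi a b : size (phi (fg_letter (a, b))) =
  size (phi (fg_gen a)).
Proof.
case: b => //; have -> : fg_letter (a, true) = (fg_gen a)^-1 by exact: val_inj.
by rewrite autV /= size_rev size_map.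
Qed.

(** The total length of the images of the generators bounds each of them, hence is a Lipschitz
    constant; a program obtains it by concatenating input words and taking the size. *)
Lemma size_aut phi w :
  (size (phi w) <=
   size (flatten [seq word (phi (fg_gen a)) | a <- enum A]) * size w)%N.
Proof.
case: w; set K := size (flatten _); elim=> [|x w IHw] rw.
  have -> : FreeGroup rw = 1 by apply: val_inj.
  by rewrite aut1.
rewrite [X in phi X]fg_cons gmulfM (leq_trans (size_mulg _ _)) //=.
rewrite mulnS leq_add ?IHw //; case: x {rw} => a b; rewrite size_aut_letter /K.
have : a \in enum A by rewrite mem_enum.
elim: (enum A) => //= a' s IHs; rewrite inE size_cat => /predU1P[->|/IHs]; lia.
Qed.

(* Consecutive prefixes of X have images agreeing up to the length of the
   image of a letter, and these images are long because the inverse of phi is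
   Lipschitz. *)
Lemma boundary_map_agree phi k L X :
  let M := size (flatten [seq word (phi (fg_gen a)) | a <- enum A]) in
  let K := size (flatten [seq word (aut_inv phi (fg_gen a)) | a <- enum A]) in
  (K * (k + M) < L)%N ->
  agree k (inr (boundary_map phi X)) (inl (phi (bprefix X L))).
Proof.
move=> M K lt_L.
have sizeX n : (L <= n)%N -> (k + M < size (phi (bprefix X n)))%N.
  move=> le_Ln; have := size_aut (inverse_aut phi) (phi (bprefix X n)).
  rewrite !inverse_autE autK size_bprefix -/K => le_n.
  by rewrite -(@ltn_pmul2l K); lia.
have agreeX n : (L <= n)%N ->
    agree k (inl (phi (bprefix X L))) (inl (phi (bprefix X n))).
  elim: n => [|n IHn]; first by rewrite leqn0 => /eqP->.
  rewrite leq_eqVlt => /predU1P[<- //|le_Ln].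
  apply: (agree_trans (IHn le_Ln)); rewrite bprefixS gmulfM.
  apply: agree_leq (@agree_mul _ _ _); have := size_aut phi (fg_letter (X n)).
  by rewrite muln1 -/M; move: (sizeX n le_Ln); lia.
have [N XN] := boundary_mapP phi X k.
apply: (agree_trans (y := inl (phi (bprefix X (maxn L N))))).
  apply: (XN (inl _)); apply: agree_leq (@agree_bprefix _ _ _); exact: leq_maxr.
by apply: agree_sym; apply: agreeX; apply: leq_maxl.
Qed.

(** By [between_prefix], equal lengths turn both shadows into sets of ends with a prescribed
    prefix. *)
Lemma double_cylinder_prefix u v X Y : size u = size v -> u <> v ->
  double_cylinder u v (X, Y) <->
  bprefix X (size u) = u /\ bprefix Y (size v) = v.
Proof.
move=> suv neq_uv.
have prefixP w Z : prefix (word w) (word (bprefix Z (size w).+1)) <->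
    bprefix Z (size w) = w.
  rewrite -[(size w).+1]addn1 bprefixD; split; last first.
    by move=> {1}<-; apply: prefix_prefix.
  rewrite prefixE => /eqP def_w; apply: val_inj; rewrite -[RHS]def_w.
  by rewrite take_size_cat ?size_bprefix.
have neq_vu : v <> u by exact: nesym.
by rewrite double_cylinderP // /shadow /= !between_prefix // !prefixP.
Qed.

(** By the agreement hypothesis, the prefix of length [L] of an end decides in which shadows its
    preimage under [phi] lies. The words of [us] and [vs] all have length [L], so their double
    cylinders merely prescribe these prefixes. *)
Lemma decompositionP phi u v L (us vs : seq (freeGroup A)) : u <> v ->
  (forall X, agree (maxn (size u) (size v)).+1
     (inr (boundary_map (inverse_aut phi) X))
     (inl (aut_inv phi (bprefix X L)))) ->
  (forall w, (w \in us) = (size w == L) && between v u (aut_inv phi w)) ->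
  (forall w, (w \in vs) = (size w == L) && between u v (aut_inv phi w)) ->
  is_decomposition phi u v [set` us] [set` vs].
Proof.
move=> neq_uv agreeL usE vsE.
(* The preimage of a common word would lie beyond [u] seen from [v] and beyond [v] seen from [u]. *)
have neq_us_vs u' v' : u' \in us -> v' \in vs -> u' <> v'.
  rewrite usE vsE => /andP[_ u'P] /andP[_ v'P] eq_uv.
  apply: neq_uv; apply: (between_antisym (c := aut_inv phi u')).
    by rewrite eq_uv.
  by [].
have cylP u' v' X Y : u' \in us -> v' \in vs -> double_cylinder u' v' (X, Y) <->
    bprefix X L = u' /\ bprefix Y L = v'.
  move=> u'us v'vs; have neq := neq_us_vs _ _ u'us v'vs; move: u'us v'vs.
  rewrite usE vsE => /andP[/eqP su' _] /andP[/eqP sv' _].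
  by rewrite double_cylinder_prefix ?su' ?sv'.
split; [exact: finite_seq|exact: finite_seq|exact: neq_us_vs| |]; last first.
  (* A pair of ends common to two double cylinders recovers both index pairs as its prefixes of
     length [L]. *)
  move=> [u1 v1] [u2 v2] [/= u1us v1vs] [/= u2us v2vs] [[X Y] [/=]].
  by rewrite !cylP // => -[<- <-] [<- <-].
have boundary_mapK : cancel _ (boundary_map phi) :=
  @boundary_map_comp phi (inverse_aut phi) (aut_invK phi).
have boundary_mapVK : cancel (boundary_map phi) _ :=
  @boundary_map_comp (inverse_aut phi) phi (autK phi).
have usP Z : (bprefix Z L \in us) =
    (boundary_map (inverse_aut phi) Z \in shadow v u).
  by rewrite usE size_bprefix eqxx (shadowP _ (agreeL Z)) // ltnS leq_maxl.
have vsP Z : (bprefix Z L \in vs) =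
    (boundary_map (inverse_aut phi) Z \in shadow u v).
  by rewrite vsE size_bprefix eqxx (shadowP _ (agreeL Z)) // ltnS leq_maxr.
apply/seteqP; split=> [_ [[X Y] + <-]|[X Y] [[u' v'] [/= u'us v'vs]]].
  rewrite double_cylinderP // => -[sX sY].
  have Xus : bprefix (boundary_map phi X) L \in us.
    by rewrite usP boundary_mapVK in_setE.
  have Yvs : bprefix (boundary_map phi Y) L \in vs.
    by rewrite vsP boundary_mapVK in_setE.
  by exists (bprefix (boundary_map phi X) L, bprefix (boundary_map phi Y) L);
    rewrite //= cylP.
rewrite cylP // => -[def_u' def_v'].
exists (boundary_map (inverse_aut phi) X, boundary_map (inverse_aut phi) Y).
  rewrite double_cylinderP // -[shadow v u _]in_setE -[shadow u v _]in_setE.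
  by rewrite -usP -vsP def_u' def_v'.
by rewrite /boundary_map2 /= !boundary_mapK.
Qed.
End Automorphisms.

(** * Computability by WHILE programs *)

Section Termination.
Implicit Types (c : command) (s : store) (Q : store -> Prop).

Definition terminates c s Q : Prop := exists2 s', exec c s s' & Q s'.

Lemma terminates_weaken c s Q Q' :
  terminates c s Q -> (forall s', Q s' -> Q' s') -> terminates c s Q'.
Proof. by case=> s' cs Qs QQ'; exists s' => //; apply: QQ'. Qed.

Lemma terminates_assign n e s Q :
  Q (update s n (eval s e)) -> terminates (Assign n e) s Q.
Proof. by move=> Qs; exists (update s n (eval s e)) => //; constructor. Qed.

Lemma terminates_seq c1 c2 s Q :
  terminates c1 s (fun s1 => terminates c2 s1 Q) -> terminates (Seq c1 c2) s Q.
Proof. by case=> s1 cs1 [s2 cs2 Qs]; exists s2 => //; apply: exec_seq cs1 cs2. Qed.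

Lemma terminates_while_false e c s Q :
  eval s e = Leaf -> Q s -> terminates (While e c) s Q.
Proof. by move=> es Qs; exists s => //; apply: exec_while_false. Qed.

Lemma terminates_while_true e c s Q : eval s e <> Leaf ->
  terminates c s (fun s1 => terminates (While e c) s1 Q) ->
  terminates (While e c) s Q.
Proof.
by move=> es [s1 cs1 [s2 cs2 Qs]]; exists s2 => //; apply: exec_while_true cs2.
Qed.

Lemma updateE s n t : update s n t n = t.
Proof. by rewrite /update eqxx. Qed.

Lemma updateN s m n t : m != n -> update s n t m = s m.
Proof. by rewrite /update => /negbTE->. Qed.

End Termination.

Ltac upd := rewrite /=;
  repeat first [rewrite updateE | rewrite updateN; [|by lia]].

(** Canonical instances let the type of a function determine how its arguments and values are
    coded. *)
Structure codeType := CodeType { code_sort :> Type; code : code_sort -> tree }.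

Canonical bool_code := CodeType tree_of_bool.
Canonical nat_code := CodeType tree_of_nat.
Canonical letter_code (A : finType) := CodeType (@tree_of_letter A).
Canonical seq_code (T : codeType) := CodeType (tree_of_seq (@code T)).
Canonical prod_code (T U : codeType) :=
  @CodeType (T * U)%type (fun p => Node (code p.1) (code p.2)).

(* The registers from n onwards are scratch space: they may initially hold
   anything, so that programs for subroutines can be run on fresh registers. *)
Definition realizes (T U : codeType) (n : nat) (c : command) (f : T -> U) :=
  forall s x, s n = code x -> terminates c s (fun s' =>
    s' n = code (f x) /\ forall m, (m < n)%N -> s' m = s m).

Definition computable (T U : codeType) (f : T -> U) : Prop :=
  forall n, exists c, realizes n c f.

Lemma terminates_call (T U : codeType) n c (f : T -> U) s x (Q : store -> Prop) :
  realizes n c f -> s n = code x ->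
  (forall s', s' n = code (f x) -> (forall m, (m < n)%N -> s' m = s m) -> Q s') ->
  terminates c s Q.
Proof.
by move=> cf sx QP; apply: terminates_weaken (cf s x sx) _ => s' [? ?]; apply: QP.
Qed.

(** * Composition, pairing, branching and loops *)

Section Computability.
Implicit Types (E T U V : codeType).

Lemma computable_eq T U (f g : T -> U) : f =1 g -> computable f -> computable g.
Proof.
by move=> fg cf n; have [c cP] := cf n; exists c => s x /cP; rewrite fg.
Qed.

Lemma computable_expr T U (f : T -> U) (e : nat -> expr) :
  (forall n s x, s n = code x -> eval s (e n) = code (f x)) -> computable f.
Proof.
move=> eP n; exists (Assign n (e n)) => s x /eP sx.
by apply: terminates_assign; split=> [|m lt_mn]; upd.
Qed.

Lemma computable_id T : computable (@id T).
Proof. by apply: (@computable_expr _ _ _ EVar) => n s x /=. Qed.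

Lemma computable_comp T U V (g : U -> V) (f : T -> U) :
  computable g -> computable f -> computable (fun x => g (f x)).
Proof.
move=> cg cf n; have [c cP] := cf n; have [d dP] := cg n.
exists (Seq c d) => s x sx.
apply/terminates_seq/(terminates_call cP sx) => s1 s1n s1m.
apply/(terminates_call dP s1n) => s2 s2n s2m; split=> // m lt_mn.
by rewrite s2m ?s1m.
Qed.

Lemma computable_const T U (y : U) : computable (fun _ : T => y).
Proof.
pose fix quote t := if t is Node t1 t2 then ENode (quote t1) (quote t2) else ELeaf.
apply: (@computable_expr _ _ _ (fun=> quote (code y))) => n s x _.
by elim: (code y) => //= t1 -> t2 ->.
Qed.

Lemma computable_pair T U V (f : T -> U) (g : T -> V) :
  computable f -> computable g -> computable (fun x => (f x, g x)).
Proof.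
move=> cf cg n; have [c cP] := cf n.+1; have [d dP] := cg n.+2.
(* The first value, in [n.+1], survives the second call because that call runs from [n.+2] onwards;
   the input in [n] survives both. *)
exists (Seq (Assign n.+1 (EVar n)) (Seq c (Seq (Assign n.+2 (EVar n))
  (Seq d (Assign n (ENode (EVar n.+1) (EVar n.+2))))))) => s x sx.
apply/terminates_seq/terminates_assign/terminates_seq.
apply: (terminates_call (x := x) cP); first by upd.
move=> s1 s1n s1m; apply/terminates_seq/terminates_assign/terminates_seq.
apply: (terminates_call (x := x) dP); first by upd; rewrite s1m //; upd.
move=> s2 s2n s2m; apply/terminates_assign; split=> [|m lt_mn]; upd.
  by rewrite s2n s2m //; upd; rewrite s1n.
by rewrite s2m; [upd; rewrite s1m; [upd|lia]|lia].
Qed.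

Lemma computable_fst T U V (f : T -> U * V) :
  computable f -> computable (fun x => (f x).1).
Proof.
apply: (@computable_comp _ (prod_code U V) _ fst).
by apply: (@computable_expr (prod_code U V) U _
  (fun n => EHead (EVar n))) => n s x /= ->.
Qed.

Lemma computable_snd T U V (f : T -> U * V) :
  computable f -> computable (fun x => (f x).2).
Proof.
apply: (@computable_comp _ (prod_code U V) _ snd).
by apply: (@computable_expr (prod_code U V) V _
  (fun n => ETail (EVar n))) => n s x /= ->.
Qed.

(** A nonempty list has the same code as the pair of its head and tail. *)
Lemma computable_cons E T (f : E -> T) (g : E -> seq T) :
  computable f -> computable g -> computable (fun e => f e :: g e).
Proof. exact: computable_pair. Qed.

Lemma computable_succ T (f : T -> nat) :
  computable f -> computable (fun x => (f x).+1).
Proof.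
apply: (@computable_comp _ nat_code nat_code succn).
by apply: (@computable_expr _ nat_code succn
  (fun n => ENode ELeaf (EVar n))) => n s x /= ->.
Qed.

Lemma tree_eqP s t : reflect (s = t) (tree_eqb s t).
Proof.
elim: s t => [|s1 IH1 s2 IH2] [|t1 t2] /=; try by constructor.
apply: (iffP andP) => [[/IH1-> /IH2->] //|[<- <-]].
by split; [apply/IH1|apply/IH2].
Qed.

Lemma computable_eqop E T (eqT : rel T) (f g : E -> T) :
  (forall x y, eqT x y <-> code x = code y) ->
  computable f -> computable g -> computable (fun e => eqT (f e) (g e)).
Proof.
move=> eqTP cf cg.
have ceq : @computable (prod_code T T) bool_code (fun p => eqT p.1 p.2).
  apply: (@computable_expr _ _ _ (fun n => EEq (EHead (EVar n)) (ETail (EVar n)))).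
  move=> n s [x y] /= ->; congr tree_of_bool.
  by apply/tree_eqP/idP => /eqTP.
exact: computable_comp ceq (computable_pair cf cg).
Qed.

(** Branching is done by two loops that run at most once. The nonempty branch clears the list in
    [n.+1], ending its own loop, and the flag in [n.+2], which would otherwise start the loop of the
    empty branch. *)
Lemma computable_match E T U (l : E -> seq T) (F : E -> T -> seq T -> U)
    (G : E -> U) :
  computable l -> computable (fun p : E * (T * seq T) => F p.1 p.2.1 p.2.2) ->
  computable G ->
  computable (fun e => if l e is x :: s then F e x s else G e).
Proof.
move=> cl cF cG n; have [c cP] := cl n.+1.
have [d dP] := cF n.+3; have [b bP] := cG n.+3.
exists (Seq (Assign n.+1 (EVar n)) (Seq c (Seq (Assign n.+2 (ENode ELeaf ELeaf))
  (Seq (While (EVar n.+1)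
    (Seq (Assign n.+3 (ENode (EVar n) (EVar n.+1))) (Seq d
      (Seq (Assign n (EVar n.+3)) (Seq (Assign n.+1 ELeaf) (Assign n.+2 ELeaf))))))
  (While (EVar n.+2)
    (Seq (Assign n.+3 (EVar n)) (Seq b
      (Seq (Assign n (EVar n.+3)) (Assign n.+2 ELeaf)))))))))
  => s e se.
apply/terminates_seq/terminates_assign/terminates_seq.
apply: (terminates_call (x := e) cP); first by upd.
move=> s1 s1n s1m; apply/terminates_seq/terminates_assign/terminates_seq.
case def_l: (l e) s1n => [|x w] s1n.
  apply: terminates_while_false; first by upd; rewrite s1n.
  apply: terminates_while_true; first by upd.
  apply/terminates_seq/terminates_assign/terminates_seq.
  apply: (terminates_call (x := e) bP); first by upd; rewrite s1m //; upd.
  move=> s2 s2n s2m.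
  apply/terminates_seq/terminates_assign/terminates_assign.
  apply: terminates_while_false; first by upd.
  split=> [|m lt_mn]; upd; first by [].
  by rewrite s2m; [upd; rewrite s1m; [upd|lia]|lia].
apply: terminates_while_true; first by upd; rewrite s1n.
apply/terminates_seq/terminates_assign/terminates_seq.
apply: (terminates_call (x := (e, (x, w))) dP).
  by upd; rewrite s1n s1m //; upd; rewrite se.
move=> s2 s2n s2m.
do 2!apply/terminates_seq/terminates_assign; apply/terminates_assign.
apply: terminates_while_false; first by upd.
apply: terminates_while_false; first by upd.
split=> [|m lt_mn]; upd; first by [].
by rewrite s2m; [upd; rewrite s1m; [upd|lia]|lia].
Qed.

Lemma computable_if E U (b : E -> bool) (f g : E -> U) :
  computable b -> computable f -> computable g ->
  computable (fun e => if b e then f e else g e).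
Proof.
move=> cb cf cg.
(* A boolean has the same code as a list of that length. *)
have cb' : computable (fun e => nseq (b e) false).
  move=> n; have [c cP] := cb n; exists c => s x /cP.
  by rewrite /= /tree_of_seq; case: (b x).
have cf' := computable_comp cf
  (computable_fst (@computable_id (E * (bool * seq bool))%type)).
have := computable_match (F := fun e _ _ => f e) cb' cf' cg.
by apply: computable_eq => e /=; case: (b e).
Qed.

Lemma computable_foldl E T U (F : E -> U -> T -> U) (a : E -> U) (l : E -> seq T) :
  computable (fun p : E * (U * T) => F p.1 p.2.1 p.2.2) ->
  computable a -> computable l ->
  computable (fun e => foldl (F e) (a e) (l e)).
Proof.
move=> cF ca cl n; have [c cP] := ca n.+1; have [b bP] := cl n.+2.
have [d dP] := cF n.+3.
(* Register [n] keeps the parameter, [n.+1] the accumulator and [n.+2] the remaining list; the body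
   is called on [n.+3]. *)
exists (Seq (Assign n.+1 (EVar n)) (Seq c (Seq (Assign n.+2 (EVar n)) (Seq b
  (Seq (While (EVar n.+2)
     (Seq (Assign n.+3 (ENode (EVar n) (ENode (EVar n.+1) (EHead (EVar n.+2)))))
     (Seq d (Seq (Assign n.+1 (EVar n.+3)) (Assign n.+2 (ETail (EVar n.+2)))))))
   (Assign n (EVar n.+1))))))) => s e se.
apply/terminates_seq/terminates_assign/terminates_seq.
apply: (terminates_call (x := e) cP); first by upd.
move=> s1 s1n s1m; apply/terminates_seq/terminates_assign/terminates_seq.
apply: (terminates_call (x := e) bP); first by upd; rewrite s1m //; upd.
move=> s2 s2n s2m; apply/terminates_seq.
(* Together with the code of the remaining list in [n.+2], the next three facts form the loop
   invariant. *)
have {se} s2e : s2 n = code e by rewrite s2m //; upd; rewrite s1m //; upd.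
have {s1n} : s2 n.+1 = code (a e) by rewrite s2m //; upd.
have {s1m s2m} : forall m, (m < n)%N -> s2 m = s m.
  by move=> m lt_mn; rewrite s2m; [upd; rewrite s1m; [upd|lia]|lia].
elim: (l e) (a e) s2 s2n s2e => [|x w IHw] y s2 s2n s2e s2m s2a.
  apply: terminates_while_false; first by rewrite /= s2n.
  by apply: terminates_assign; split=> [|m lt_mn]; upd => //; rewrite s2m.
apply: terminates_while_true; first by rewrite /= s2n.
apply/terminates_seq/terminates_assign/terminates_seq.
apply: (terminates_call (x := (e, (y, x))) dP).
  by upd; rewrite s2e s2a s2n.
move=> s3 s3n s3m; apply/terminates_seq/terminates_assign/terminates_assign.
apply: IHw; upd => //; first by rewrite s3m //; upd; rewrite s2n.
  by rewrite s3m //; [upd|lia].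
by move=> m lt_mn; upd; rewrite s3m; [upd; rewrite s2m|lia].
Qed.

End Computability.

(** * Folds, iteration and standard functions on lists *)

Section ListOperations.
Implicit Types (E T U V : codeType).

Lemma computable_rev E T (l : E -> seq T) :
  computable l -> computable (fun e => rev (l e)).
Proof.
move=> cl; have := @computable_foldl E T (seq_code T)
  (fun _ s x => x :: s) (fun=> [::]) l.
move=> /(_ _ (computable_const _ _) cl) crev.
apply: computable_eq (crev _) => [e|]; last first.
  apply: computable_cons; first by do 2!apply: computable_snd; exact: computable_id.
  by apply: computable_fst; exact: computable_snd (computable_id _).
by rewrite /rev; elim: (l e) [::] => //= x s IHs t.
Qed.

Lemma computable_foldr E T U (F : E -> T -> U -> U) (a : E -> U) (l : E -> seq T) :
  computable (fun p : E * (T * U) => F p.1 p.2.1 p.2.2) ->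
  computable a -> computable l ->
  computable (fun e => foldr (F e) (a e) (l e)).
Proof.
move=> cF ca cl.
have cF' : computable (fun p : E * (U * T) => F p.1 p.2.2 p.2.1).
  apply: (computable_comp cF (f := fun p : E * (U * T) => (p.1, (p.2.2, p.2.1)))).
  apply: computable_pair; first exact: computable_fst (computable_id _).
  apply: computable_pair; [apply: computable_snd|apply: computable_fst];
    exact: computable_snd (computable_id _).
have := computable_foldl (F := fun e u x => F e x u) cF' ca (computable_rev cl).
by apply: computable_eq => e; rewrite foldl_rev.
Qed.

Lemma computable_iter E T (F : E -> T -> T) (n : E -> nat) (a : E -> T) :
  computable (fun p : E * T => F p.1 p.2) -> computable n -> computable a ->
  computable (fun e => iter (n e) (F e) (a e)).
Proof.
move=> cF cn ca.
have cF' : computable (fun p : E * (bool * T) => F p.1 p.2.2).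
  apply: (computable_comp cF (f := fun p : E * (bool * T) => (p.1, p.2.2))).
  apply: computable_pair; first exact: computable_fst (computable_id _).
  by apply: computable_snd; exact: computable_snd (computable_id _).
(* A natural number has the same code as a list of that length. *)
have cn' : computable (fun e => nseq (n e) false).
  move=> k; have [c cP] := cn k; exists c => s x /cP; congr (terminates c s).
  apply/funext => s'; congr (_ = _ /\ _); rewrite /= /tree_of_seq.
  by elim: (n x) => //= m ->.
have := computable_foldr (F := fun e _ x => F e x) cF' ca cn'.
by apply: computable_eq => e; elim: (n e) => //= m ->.
Qed.

Lemma computable_map E T U (F : E -> T -> U) (l : E -> seq T) :
  computable (fun p : E * T => F p.1 p.2) -> computable l ->
  computable (fun e => [seq F e x | x <- l e]).
Proof.
move=> cF cl.
have cF' : computable (fun p : E * (T * seq U) => F p.1 p.2.1 :: p.2.2).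
  apply: computable_cons; last first.
    by apply: computable_snd; exact: computable_snd (computable_id _).
  apply: (computable_comp cF (f := fun p : E * (T * seq U) => (p.1, p.2.1))).
  apply: computable_pair; first exact: computable_fst (computable_id _).
  by apply: computable_fst; exact: computable_snd (computable_id _).
have := computable_foldr (F := fun e x s => F e x :: s) cF' (computable_const _ [::]) cl.
by apply: computable_eq => e; elim: (l e) => //= x s ->.
Qed.

Lemma computable_filter E T (P : E -> T -> bool) (l : E -> seq T) :
  computable (fun p : E * T => P p.1 p.2) -> computable l ->
  computable (fun e => [seq x <- l e | P e x]).
Proof.
move=> cP cl.
have c1 : computable (fun p : E * (T * seq T) => p.2.1).
  by apply: computable_fst; exact: computable_snd (computable_id _).
have c2 : computable (fun p : E * (T * seq T) => p.2.2).
  by apply: computable_snd; exact: computable_snd (computable_id _).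
have cP' : computable (fun p : E * (T * seq T) =>
    if P p.1 p.2.1 then p.2.1 :: p.2.2 else p.2.2).
  apply: computable_if => //; last exact: computable_cons.
  apply: (computable_comp cP (f := fun p : E * (T * seq T) => (p.1, p.2.1))).
  exact: computable_pair (computable_fst (computable_id _)) c1.
have := computable_foldr (F := fun e x s => if P e x then x :: s else s) cP'
  (computable_const _ [::]) cl.
by apply: computable_eq => e; elim: (l e) => //= x s ->.
Qed.

Lemma computable_cat E T (f g : E -> seq T) :
  computable f -> computable g -> computable (fun e => f e ++ g e).
Proof.
move=> cf cg.
have ccons : computable (fun p : E * (T * seq T) => p.2.1 :: p.2.2).
  by move: (computable_snd (computable_id (prod_code E (prod_code T (seq_code T))))).
have := computable_foldr (F := fun=> cons) ccons cg cf.
by apply: computable_eq => e; elim: (f e) => //= x s ->.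
Qed.

Lemma computable_flatten E T (f : E -> seq (seq T)) :
  computable f -> computable (fun e => flatten (f e)).
Proof.
apply: (computable_foldr (F := fun=> cat)); last exact: computable_const.
apply: computable_cat; [apply: computable_fst|apply: computable_snd];
  exact: computable_snd (computable_id _).
Qed.

Lemma computable_size E T (f : E -> seq T) :
  computable f -> computable (fun e => size (f e)).
Proof.
move=> cf.
have cS : computable (fun p : E * (T * nat) => p.2.2.+1).
  apply: computable_succ; apply: computable_snd; exact: computable_snd (computable_id _).
have := computable_foldr (F := fun _ _ n => n.+1) cS (computable_const _ 0%N) cf.
by apply: computable_eq => e; elim: (f e) => //= x s ->.
Qed.

(** Iterating [behead] stays at the empty list once it is reached, so an index out of range falls
    into the empty branch and yields [x]. *)
Lemma computable_nth E T (x : T) (f : E -> seq T) (n : E -> nat) :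
  computable f -> computable n -> computable (fun e => nth x (f e) (n e)).
Proof.
move=> cf cn.
have cbehead : computable (fun p : E * seq T => behead p.2).
  apply: (computable_match (F := fun _ _ s => s) (G := fun=> [::])).
  - exact: computable_snd (computable_id _).
  - by do 2!apply: computable_snd; exact: computable_id.
  - exact: computable_const.
have citer := computable_iter (F := fun=> behead) cbehead cn cf.
have chead : computable (fun p : E * (T * seq T) => p.2.1).
  by apply: computable_fst; exact: computable_snd (computable_id _).
have := computable_match (F := fun _ y _ => y) citer chead (computable_const _ x).
apply: computable_eq => e.
have -> : iter (n e) behead (f e) = drop (n e) (f e).
  elim: (n e) => [|m /= ->]; first by rewrite drop0.
  by rewrite -drop1 drop_drop add1n.
by rewrite -[in RHS](addn0 (n e)) -nth_drop; case: (drop _ _).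
Qed.

Lemma code_seq_inj T : injective (@code T) -> injective (@code (seq_code T)).
Proof. by move=> injT; elim=> [|x s IHs] [|y t] //= [/injT-> /IHs->]. Qed.

Lemma code_letter_inj (A : finType) : injective (@code (letter_code A)).
Proof.
have nat_inj : injective tree_of_nat by elim=> [|m IHm] [|n] //= [/IHm->].
case=> [a b] [a' b'] /= [/nat_inj/ord_inj/enum_rank_inj/= -> eb].
by case: b b' eb => [] [].
Qed.

End ListOperations.

(** * The algorithm *)

Section Algorithm.
Variable A : finType.
Implicit Types (E : codeType) (s t : seq (letter A)) (imgs : seq (seq (letter A))).

Lemma computable_linv E (x : E -> letter A) :
  computable x -> computable (fun e => linv (x e)).
Proof.
apply: (computable_comp (g := @linv A)).
(* Comparison with [ELeaf], the code of [false], negates the sign of the letter. *)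
apply: (@computable_expr _ _ _ (fun n =>
  ENode (EHead (EVar n)) (EEq (ETail (EVar n)) ELeaf))).
by move=> n s [a b] /= ->; case: b.
Qed.

Lemma computable_rank E (x : E -> letter A) :
  computable x -> computable (fun e => nat_of_ord (enum_rank (x e).1)).
Proof.
apply: (computable_comp (g := fun x : letter A => nat_of_ord (enum_rank x.1))).
by apply: (@computable_expr _ _ _ (fun n => EHead (EVar n))) => n s [a b] /= ->.
Qed.

Lemma computable_sign E (x : E -> letter A) :
  computable x -> computable (fun e => (x e).2).
Proof.
apply: (computable_comp (g := fun x : letter A => x.2)).
by apply: (@computable_expr _ _ _ (fun n => ETail (EVar n))) => n s [a b] /= ->.
Qed.

Lemma computable_rcons_letter E (x : E -> letter A) (f : E -> seq (letter A)) :
  computable x -> computable f -> computable (fun e => rcons_letter (x e) (f e)).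
Proof.
move=> cx cf.
apply: (@computable_match E (letter_code A) (seq_code (letter_code A)) f
  (fun e y w => if y == linv (x e) then w else x e :: f e) (fun e => [:: x e])) => //;
  last exact: computable_cons (computable_const _ _).
pose E' := prod_code E (prod_code (letter_code A) (seq_code (letter_code A))).
have c0 := computable_fst (computable_id E').
have cxp := computable_comp cx c0; have cfp := computable_comp cf c0.
apply: computable_if; last exact: computable_cons.
  apply: (computable_eqop (eqT := fun y z : letter A => y == z)).
  - by move=> y z; split=> [/eqP->|/code_letter_inj->].
  - by apply: computable_fst; exact: computable_snd (computable_id _).
  - exact: computable_linv.
by apply: computable_snd; exact: computable_snd (computable_id _).
Qed.

Lemma computable_rcat E (f g : E -> seq (letter A)) :
  computable f -> computable g -> computable (fun e => rcat (f e) (g e)).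
Proof.
move=> cf cg; apply: (computable_foldr (F := fun=> @rcons_letter A)) => //.
apply: computable_rcons_letter; [apply: computable_fst|apply: computable_snd];
  exact: computable_snd (computable_id _).
Qed.

Lemma computable_rinv E (f : E -> seq (letter A)) :
  computable f -> computable (fun e => rinv (f e)).
Proof.
move=> cf; apply/computable_rev/(computable_map (F := fun=> @linv A)) => //.
exact: computable_linv (computable_snd (computable_id _)).
Qed.

(** A word is reduced exactly when its product with the empty word, computed with cancellation,
    gives it back. *)
Lemma computable_reduced E (f : E -> seq (letter A)) :
  computable f -> computable (fun e => reduced (f e)).
Proof.
move=> cf; have eqP_code (s t : seq (letter A)) : s == t <-> code s = code t.
  by split=> [/eqP->|/(code_seq_inj (@code_letter_inj A))->].
have := computable_eqop eqP_code (computable_rcat cf (computable_const _ [::])) cf.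
apply: computable_eq => e; apply/eqP/idP => [<-|rf]; first exact: reduced_rcat.
by rewrite rcat_reduced ?cats0.
Qed.

(** The list [imgs] stands for an endomorphism: it holds the images of the generators in the order
    of [enum A]. *)
Definition letter_image imgs (x : letter A) : seq (letter A) :=
  if x.2 then rinv (nth [::] imgs (enum_rank x.1))
  else nth [::] imgs (enum_rank x.1).

Definition word_image imgs s : seq (letter A) :=
  foldr (fun x t => rcat (letter_image imgs x) t) [::] s.

Lemma computable_word_image E (imgs : E -> seq (seq (letter A)))
    (f : E -> seq (letter A)) :
  computable imgs -> computable f ->
  computable (fun e => word_image (imgs e) (f e)).
Proof.
move=> ci cf.
apply: (computable_foldr
  (F := fun e x t => rcat (letter_image (imgs e) x) t)) => //;
  last exact: computable_const.
pose E' := prod_code E (prod_code (letter_code A) (seq_code (letter_code A))).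
have cx := computable_fst (computable_snd (computable_id E')).
have cn : computable (fun p : E * (letter A * seq (letter A)) =>
    nth [::] (imgs p.1) (enum_rank p.2.1.1)).
  apply: computable_nth; last exact: computable_rank.
  exact: computable_comp ci (computable_fst (computable_id _)).
apply: computable_rcat; last first.
  by apply: computable_snd; exact: computable_snd (computable_id _).
by apply: computable_if => //; [exact: computable_sign|exact: computable_rinv].
Qed.

(** Words that are not reduced are produced too; [side_words] discards them. *)
Definition extend_words (ws : seq (seq (letter A))) : seq (seq (letter A)) :=
  flatten [seq [seq x :: w | x <- enum {: letter A}] | w <- ws].

Lemma computable_extend_words E (ws : E -> seq (seq (letter A))) :
  computable ws -> computable (fun e => extend_words (ws e)).
Proof.
move=> cws; apply/computable_flatten.
apply: (computable_map (F := fun _ w => [seq x :: w | x <- enum {: letter A}])) => //.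
apply: (computable_map (F := fun (p : E * seq (letter A)) x => x :: p.2));
  last exact: computable_const.
apply: computable_cons; first exact: computable_snd (computable_id _).
by apply: computable_snd; exact: computable_fst (computable_id _).
Qed.

Lemma mem_extend_words n ws : (forall w, (w \in ws) = (size w == n)) ->
  forall w, (w \in extend_words ws) = (size w == n.+1).
Proof.
move=> wsP w; apply/flatten_mapP/eqP => [[t + /mapP[x _ ->]]|].
  by rewrite wsP /= => /eqP->.
case: w => // x w [sw]; exists w; first by rewrite wsP sw.
by rewrite map_f ?mem_enum.
Qed.

Lemma mem_iter_extend_words m n ws : (forall w, (w \in ws) = (size w == n)) ->
  forall w, (w \in iter m extend_words ws) = (size w == m + n)%N.
Proof. by move=> wsP; elim: m => [//|m IHm] w; rewrite (mem_extend_words IHm). Qed.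

(** The second test is [between a b] at the image of [w], spelled out on plain sequences of letters
    so that a program can run it. *)
Definition side_words a b imgs (ws : seq (seq (letter A))) :=
  [seq w <- ws | reduced w &&
     reduced (rcat (rinv a) b ++ rcat (rinv b) (word_image imgs w))].

Lemma computable_side_words E (a b : E -> seq (letter A))
    (imgs ws : E -> seq (seq (letter A))) :
  computable a -> computable b -> computable imgs -> computable ws ->
  computable (fun e => side_words (a e) (b e) (imgs e) (ws e)).
Proof.
move=> ca cb ci cws.
have c1 := computable_fst (computable_id (prod_code E (seq_code (letter_code A)))).
have c2 := computable_snd (computable_id (prod_code E (seq_code (letter_code A)))).
apply: (computable_filter (P := fun e w => reduced w &&
  reduced (rcat (rinv (a e)) (b e) ++
           rcat (rinv (b e)) (word_image (imgs e) w)))) => //.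
apply: computable_if; last exact: computable_const.
  exact: computable_reduced.
have cap := computable_comp ca c1; have cbp := computable_comp cb c1.
apply/computable_reduced/computable_cat.
  by apply: computable_rcat => //; apply: computable_rinv.
apply: computable_rcat; first exact: computable_rinv.
by apply: computable_word_image => //; exact: computable_comp ci c1.
Qed.

Local Notation input_type :=
  ((seq (letter A) * seq (letter A)) *
   (seq (seq (letter A)) * seq (seq (letter A))))%type.

(** This one number bounds the lengths of both words and both Lipschitz constants. *)
Definition input_size (p : input_type) : nat :=
  size (p.1.1 ++ p.1.2 ++ flatten p.2.1 ++ flatten p.2.2).

(** With N the input size, nested iteration starting from words of length 1 reaches length N^2+1
    without programming a multiplication. *)
Definition candidate_words (p : input_type) : seq (seq (letter A)) :=
  iter (input_size p) (iter (input_size p) extend_words) (extend_words [:: [::]]).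

Definition double_cylinder_algorithm (p : input_type) :
    seq (seq (letter A)) * seq (seq (letter A)) :=
  (side_words p.1.2 p.1.1 p.2.2 (candidate_words p),
   side_words p.1.1 p.1.2 p.2.2 (candidate_words p)).

Lemma mem_candidate_words p w :
  (w \in candidate_words p) = (size w == (input_size p * input_size p).+1).
Proof.
rewrite /candidate_words -iterM (@mem_iter_extend_words _ 1%N) ?addn1 // => t.
by rewrite (@mem_extend_words 0%N) // => t'; rewrite inE; case: t'.
Qed.

Lemma computable_input_size : computable input_size.
Proof.
have c0 : computable (fun p : input_type => p) by exact: computable_id.
apply/computable_size/computable_cat; first by do 2!apply: computable_fst.
apply: computable_cat; first by apply: computable_snd; apply: computable_fst.
apply: computable_cat; apply: computable_flatten.
  by apply: computable_fst; apply: computable_snd.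
by do 2!apply: computable_snd.
Qed.

Lemma computable_candidate_words : computable candidate_words.
Proof.
have cn := computable_input_size.
have cn1 (T : codeType) : computable (fun p : input_type * T => input_size p.1).
  exact: computable_comp cn (computable_fst (computable_id _)).
apply: (computable_iter (F := fun p => iter (input_size p) extend_words)) => //;
  last exact: computable_const.
apply: (computable_iter (F := fun=> extend_words)) => //.
  exact: computable_extend_words (computable_snd (computable_id _)).
exact: computable_snd (computable_id _).
Qed.

Lemma computable_double_cylinder_algorithm : computable double_cylinder_algorithm.
Proof.
have c0 : computable (fun p : input_type => p) by exact: computable_id.
have c11 := computable_fst (computable_fst c0).
have c12 := computable_snd (computable_fst c0).
have c22 := computable_snd (computable_snd c0).
by apply: computable_pair; apply: computable_side_words => //;
  exact: computable_candidate_words.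
Qed.

Lemma word_imageE (phi : automorphism A) (w : freeGroup A) :
  word_image [seq word (phi (fg_gen a)) | a <- enum A] w = phi w.
Proof.
case: w => w; elim: w => [|x w IHw] rw.
  have -> : FreeGroup rw = 1 by apply: val_inj.
  by rewrite aut1.
rewrite [X in phi X]fg_cons gmulfM /= (IHw (path_sorted rw)); congr rcat.
rewrite /letter_image (nth_map x.1) -?cardE ?ltn_ord // nth_enum_rank.
case: x {rw} => a [] //=.
by have -> : fg_letter (a, true) = (fg_gen a)^-1; [exact: val_inj|rewrite autV].
Qed.

(** The sequences found by the program lift to elements of the free group because the filter retains
    only reduced ones. *)
Lemma side_words_group (a b : freeGroup A) (phi : automorphism A) ws :
  exists us : seq (freeGroup A),
    [seq word w | w <- us] =
      side_words a b [seq word (phi (fg_gen a)) | a <- enum A] ws /\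
    forall w, (w \in us) = (word w \in ws) && between a b (phi w).
Proof.
set imgs := map _ _; have [us usE] : exists us : seq (freeGroup A),
    [seq word w | w <- us] = side_words a b imgs ws.
  have : all (@reduced A) (side_words a b imgs ws).
    by apply/allP => w; rewrite mem_filter -andbA => /andP[].
  elim: side_words => [|w s IHs] /=; first by exists [::].
  by case/andP=> rw /IHs[us <-]; exists (FreeGroup rw :: us).
exists us; split=> // w.
rewrite -(mem_map (@val_inj _ _ (freeGroup A))) [map _ _]usE mem_filter andbC.
by rewrite wordP word_imageE.
Qed.
End Algorithm.

Theorem theorem1p1 (A : finType)
    (F_nonabelian : ~ (forall x y : freeGroup A, commute x y)) :
  (forall (phi : automorphism A) (u v : freeGroup A), u <> v ->
     exists U V : set (freeGroup A), is_decomposition phi u v U V) /\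
  (exists alg : command,
     forall (phi : automorphism A) (u v : freeGroup A), u <> v ->
     exists us vs : seq (freeGroup A),
       computes alg (algorithm_input phi u v) (algorithm_output us vs) /\
       is_decomposition phi u v [set` us]%classic [set` vs]%classic).
Proof.
suff alg_ok : exists alg : command,
     forall (phi : automorphism A) (u v : freeGroup A), u <> v ->
     exists us vs : seq (freeGroup A),
       computes alg (algorithm_input phi u v) (algorithm_output us vs) /\
       is_decomposition phi u v [set` us]%classic [set` vs]%classic.
  split=> // phi u v neq_uv; have [alg algP] := alg_ok.
  have [us [vs [_ decomp]]] := algP phi u v neq_uv.
  by exists [set` us], [set` vs].
(* Register 0 is where [computes] places the input and reads the output. *)
have [alg algP] := computable_double_cylinder_algorithm A 0.
exists alg => phi u v neq_uv.
pose images (psi : freeGroup A -> freeGroup A) :=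
  [seq word (psi (fg_gen a)) | a <- enum A].
pose p := ((word u, word v), (images phi, images (aut_inv phi))).
have code_words (ws : seq (freeGroup A)) :
    tree_of_words ws = code (map (@word A) ws).
  by elim: ws => //= w ws <-.
have code_images psi :
    tree_of_words [seq psi (fg_gen a) | a <- enum A] = code (images psi).
  by rewrite code_words -map_comp.
have input_code : algorithm_input phi u v = code p.
  by rewrite /algorithm_input !code_images.
(* The candidates lie on the image side, so they are tested after being pulled back by the inverse
   of [phi]. *)
have [us [us_code usP]] :=
  side_words_group v u (inverse_aut phi) (candidate_words p).
have [vs [vs_code vsP]] :=
  side_words_group u v (inverse_aut phi) (candidate_words p).
exists us, vs; split.
  rewrite /algorithm_output input_code !code_words us_code vs_code.
  have [|s s_exec [s0 _]] := algP (update (fun=> Leaf) 0 (code p)) p; first by [].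
  by exists s.
pose L := (input_size p * input_size p).+1.
apply: (@decompositionP _ _ _ _ L) => // [X|w|w]; last 2 first.
- by rewrite usP mem_candidate_words.
- by rewrite vsP mem_candidate_words.
apply: (boundary_map_agree (phi := inverse_aut phi)).
rewrite /L /input_size !size_cat /= -!/(images _).
set K := size (flatten (images phi)).
set M := size (flatten (images (aut_inv phi))).
have : (0 < size u + size v)%N.
  rewrite lt0n addn_eq0; apply/negP => /andP[/nilP u1 /nilP v1].
  by apply: neq_uv; apply: val_inj; rewrite /= u1 v1.
(* With N the input size and k = max(|u|,|v|)+1, the goal is K(k+M) < N^2+1. It is clear for K = 0;
   otherwise K and k+M are both at most N = |u|+|v|+K+M. *)
by case: K => [|K]; nia.
Qed.
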